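(* Let $f:\mathbb{R}^m\to\mathbb{R}$ be continuously differentiable and satisfy: (1) $f$ is $\mu$-PL for some $\mu>0$; (2) the set $\mathcal{X}^*=\{x\in\mathbb{R}^m \mid \nabla f(x)=0\}$ is nonempty and finite; (3) $\nabla f$ is $L$-Lipschitz continuous. Suppose the partial asynchrony assumption (given in the context) holds with a positive integer $B$. Then there exists $\gamma_0\in(0,1)$ such that for all $\gamma\in(0,\gamma_0)$, the sequence of true states $\{x(t)\}_{t\in\mathbb{N}}$ generated by the asynchronous block coordinate descent algorithm with stepsize $\gamma$ satisfies $$f(x(kB))-f^*\le(1-\gamma\mu)^{k-1}\eta,$$ $$\gamma^2\sum_{\tau=(k-1)B}^{kB-1}\|s(\tau)\|^2\le(1-\gamma\mu)^{k-1}\eta$$ for some finite constant $\eta>0$ and for all $k=0,1,2,\dots$.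
   Context: Norms are Euclidean, $[n]:=\{1,\dots,n\}$, and $f^*:=\min_{x\in\mathbb{R}^m}f(x)$. A function $f$ is $\mu$-PL (satisfies the Polyak-{\L}ojasiewicz inequality with constant $\mu>0$) if $\frac12\|\nabla f(z)\|^2\ge\mu(f(z)-f^* )$ for all $z\in\mathbb{R}^m$. $L$-Lipschitz continuity of $\nabla f$ gives in particular $f(y)\le f(x)+\nabla f(x)^T(y-x)+\frac L2\|y-x\|^2$ for all $x,y$. Asynchronous block coordinate descent: there are $n$ processors; $x\in\mathbb{R}^m$ is decomposed as $x=(x_1,\dots,x_n)$ with $x_i\in\mathbb{R}^{m_i}$, $m=\sum_{i=1}^n m_i$, and $\nabla_i f=\partial f/\partial x_i$. Time $t$ ranges over the nonnegative integers $\mathbb{N}$. Processor $i$ stores a local copy $x^i(t)=(x^i_1(t),\dots,x^i_n(t))\in\mathbb{R}^m$. For each $i$ there is a set $T^i\subseteq\mathbb{N}$ of update times of processor $i$, and with stepsize $\gamma>0$, $$x^i_i(t+1)=\begin{cases}x^i_i(t)-\gamma\nabla_i f(x^i(t)) & t\in T^i,\\ x^i_i(t) & \text{otherwise.}\end{cases}$$ For $j\ne i$, $x^i_j(t)$ is a possibly outdated value of $x^j_j$: $x^i_j(t)=x^j_j(\tau^i_j(t))$, where $\tau^i_j(t)\in\mathbb{N}$, $\tau^i_j(t)\le t$, is the time at which processor $j$ computed the value held by processor $i$ at time $t$ (this value is replaced by $x^j_j(\tau^i_j(t+1))$ when processor $i$ receives a transmission from processor $j$ at time $t+1$, and is left unchanged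 otherwise). The true state is $x(t)=(x^1_1(t),x^2_2(t),\dots,x^n_n(t))$. Define $s_i(t)=-\nabla_i f(x^i(t))$ if $t\in T^i$ and $s_i(t)=0$ otherwise, and $s(t)=[s_1(t)^T,\dots,s_n(t)^T]^T$; thus $x(t+1)=x(t)+\gamma s(t)$. By convention $s(\tau)=0$ for $\tau<0$. Partial asynchrony assumption: there exists a positive integer $B$ such that (1) for every $i\in[n]$ and $t\in\mathbb{N}$, at least one element of $\{t,t+1,\dots,t+B-1\}$ is in $T^i$; (2) $t-B<\tau^i_j(t)\le t$ for all $i,j\in[n]$, $j\ne i$, and all $t\in T^i$. *)

(* Defs.v *)
From HB Require Import structures.
From mathcomp Require Import all_boot all_order all_algebra.
From mathcomp Require Import all_classical all_reals all_analysis.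

Set Implicit Arguments.
Unset Strict Implicit.
Unset Printing Implicit Defensive.

Import Order.TTheory GRing.Theory Num.Theory.
Import numFieldNormedType.Exports.

Local Open Scope classical_set_scope.
Local Open Scope ring_scope.

(* The library norm on matrices is the sup norm, hence this definition. The   *)
(* two norms induce the same topology, so differentiability and continuity    *)
(* are taken from the library.                                                *)
Definition enorm {R : realType} {m : nat} (v : 'rV[R]_m) : R :=
  Num.sqrt (\sum_j v ord0 j ^+ 2).

(* 'D_v f x is total: grad f x is meaningful where f has partial derivatives. *)
Definition grad {R : realType} {m : nat} (f : 'rV[R]_m -> R) (x : 'rV[R]_m) :
  'rV[R]_m := \row_j 'D_(delta_mx ord0 j) f x.

Definition continuously_differentiable {R : realType} {m : nat}
  (f : 'rV[R]_m -> R) : Prop :=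
  (forall x, differentiable f x) /\ continuous (grad f).

Definition lipschitz_grad {R : realType} {m : nat} (f : 'rV[R]_m -> R) (L : R) :
  Prop := forall x y, enorm (grad f x - grad f y) <= L * enorm (x - y).

Definition is_min_value {R : realType} {m : nat} (f : 'rV[R]_m -> R)
  (fstar : R) : Prop := (exists x, f x = fstar) /\ (forall x, fstar <= f x).

Definition PL {R : realType} {m : nat} (f : 'rV[R]_m -> R) (fstar mu : R) :
  Prop := forall z, 2^-1 * enorm (grad f z) ^+ 2 >= mu * (f z - fstar).

Section AsynchronousBCD.
Context {R : realType} {n : nat} {m_ : 'I_n -> nat}.

(* R^m with m = m_1 + ... + m_n; the i-th block of x is submxrow x i.         *)
Local Notation vec := 'rV[R]_(\sum_(i < n) m_ i).

(* T i is the set of update times of processor i; tau i j t is the time at    *)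
(* which processor j computed the value of block j held by processor i at     *)
(* time t (irrelevant when j = i). Since each x i t j is determined by        *)
(* tau i j t, the reception of messages needs no separate description.        *)
Implicit Types (f : vec -> R) (T : 'I_n -> set nat)
  (tau : 'I_n -> 'I_n -> nat -> nat) (x : 'I_n -> nat -> vec).

Definition causal tau : Prop :=
  forall i j t, j != i -> (tau i j t <= t)%N.

(* Over the integers t - B < tau i j t, written without truncated subtraction *)
Definition partially_asynchronous T tau (B : nat) : Prop :=
  (forall i t, exists2 u, (t <= u < t + B)%N & u \in T i) /\
  (forall i j t, j != i -> t \in T i ->
     (t < tau i j t + B)%N /\ (tau i j t <= t)%N).

(* x i t is the local copy of the whole vector stored by processor i at t.    *)
Definition async_bcd f T tau (gamma : R) x : Prop :=
  (forall i t, submxrow (x i t.+1) i =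
     if t \in T i then submxrow (x i t) i - gamma *: submxrow (grad f (x i t)) i
     else submxrow (x i t) i) /\
  (forall i j t, j != i ->
     submxrow (x i t) j = submxrow (x j (tau i j t)) j).

Definition true_state x (t : nat) : vec := \mxrow_i submxrow (x i t) i.

(* Indexed by int to encode the convention s(t) = 0 for t < 0.                *)
Definition direction f T x (t : int) : vec :=
  match t with
  | Posz t => \mxrow_i
      (if t \in T i then - submxrow (grad f (x i t)) i else 0)
  | Negz _ => 0
  end.

End AsynchronousBCD.

(* Main.v *)
(* Let g_k be the optimality gap at time kB and P_k the sum of |s(t)|^2 over   *)
(* the B times t preceding kB. Within a window of length 2B, every local copy *)
(* used in an update is within gamma^2 2B (P_k + P_{k+1}) of the true state   *)
(* (squared distance), so the descent inequality summed over a block gives    *)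
(*   g_{k+1} <= g_k - gamma (1 - gamma K) P_{k+1} + gamma^2 K P_k,            *)
(* and, as every block is updated at least once, the PL inequality gives      *)
(*   2 mu g_k <= 3/2 P_{k+1} + gamma^2 K (P_k + P_{k+1}).                     *)
(* For small gamma these combine into V_{k+1} <= (1 - gamma mu) V_k for the   *)
(* Lyapunov function V_k = g_k + (gamma/8) P_k.                               *)
Require Import Defs.
From HB Require Import structures.
From mathcomp Require Import all_boot all_order all_algebra.
From mathcomp Require Import all_classical all_reals all_analysis.
From mathcomp Require Import ring lra zify.

Set Implicit Arguments.
Unset Strict Implicit.

Import Order.TTheory GRing.Theory Num.Theory.
Import numFieldNormedType.Exports.

Local Open Scope classical_set_scope.
Local Open Scope ring_scope.

(** Delays cost only second order in [gamma]: a copy lags by fewer than [B] steps, hence misses few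
    increments [gamma *: s], and its squared error is [gamma ^+ 2] times the recent energy
    ([copy_drift]). So [block_descent] is gradient descent up to an error charged to two consecutive
    blocks, while [block_energy] says that a large gap forces large steps. [lyapunov_step] absorbs
    the error in the weight put on [P k]. *)

(** * Descent inequality and elementary sums *)

Lemma enorm_sqr (R : realType) (p : nat) (v : 'rV[R]_p) :
  enorm v ^+ 2 = \sum_c v ord0 c ^+ 2.
Proof. by rewrite sqr_sqrtr // sumr_ge0 // => c _; exact: sqr_ge0. Qed.

Lemma lipschitz_grad_sqr (R : realType) (p : nat) (f : 'rV[R]_p -> R) (L : R)
    (x y : 'rV[R]_p) : lipschitz_grad f L ->
  enorm (grad f x - grad f y) ^+ 2 <= L ^+ 2 * enorm (x - y) ^+ 2.
Proof.
move=> fL; have := fL x y; rewrite -exprMn => le.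
(* The right-hand side is nonnegative by [le] itself, so the sign of [L] does not matter. *)
by rewrite lerXn2r // nnegrE ?(le_trans _ le) ?sqrtr_ge0.
Qed.

Lemma deriveE_grad (R : realType) (p : nat) (f : 'rV[R]_p -> R)
    (x v : 'rV[R]_p) :
  differentiable f x -> 'D_v f x = \sum_c grad f x ord0 c * v ord0 c.
Proof.
move=> fx; rewrite deriveE // {1}(row_sum_delta v) linear_sum.
by apply: eq_bigr => c _; rewrite linearZ mxE deriveE // mulrC.
Qed.

(* The constant (L^2 + 1)/2, weaker than L/2, results from bounding inner     *)
(* products by 2ab <= a^2 + b^2, and allows any sign of L.                    *)
Lemma lipschitz_grad_descent (R : realType) (p : nat) (f : 'rV[R]_p -> R) (L : R)
    (x v : 'rV[R]_p) :
  continuously_differentiable f -> lipschitz_grad f L ->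
  f (x + v) <= f x + \sum_c grad f x ord0 c * v ord0 c
               + (L ^+ 2 + 1) / 2 * enorm v ^+ 2.
Proof.
move=> [fD _] fL.
pose g (h : R) := f (h *: v + x).
pose dg h := \sum_c grad f (h *: v + x) ord0 c * v ord0 c.
have gD (h : R) : is_derive h 1 g (dg h).
  have gE : (fun k : R => k^-1 *: (g (k *: 1 + h) - g h)) =
            (fun k : R => k^-1 *: (f (k *: v + (h *: v + x)) - f (h *: v + x))).
    by apply/funext => k; rewrite /g addrA -scalerDl -[k *: 1]/(k * 1) mulr1.
  split; first by rewrite /derivable gE; exact: diff_derivable.
  by rewrite /derive gE /dg -deriveE_grad.
have gC : {within `[0, 1], continuous g}.
  apply: continuous_subspaceT => h.
  by apply/differentiable_continuous/derivable1_diffP; case: (gD h).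
(* The mean value theorem replaces the integral of the gradient along the segment. *)
have [h h01] := MVT_segment ler01 (fun h _ => gD h) gC.
rewrite subr0 mulr1 /g scale1r scale0r add0r => fE.
have {}fE : f (x + v) = f x + dg h by rewrite [x + v]addrC -fE subrKC.
rewrite fE -addrA lerD2l.
rewrite /dg -subr_le0 opprD addrA -sumrB.
have := lipschitz_grad_sqr (h *: v + x) x fL.
rewrite addrK => le.
have h2 : h ^+ 2 <= 1 by rewrite expr_le1 ?(itvP h01).
have le2 : enorm (grad f (h *: v + x) - grad f x) ^+ 2
    <= L ^+ 2 * enorm v ^+ 2.
  apply: le_trans le _; rewrite ler_wpM2l ?sqr_ge0 // !enorm_sqr.
  apply: ler_sum => c _; rewrite mxE exprMn ler_piMl ?sqr_ge0 //.
rewrite subr_le0 mulrDl mul1r mulrAC.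
have : \sum_c (grad f (h *: v + x) ord0 c * v ord0 c -
    grad f x ord0 c * v ord0 c)
  <= (enorm (grad f (h *: v + x) - grad f x) ^+ 2 + enorm v ^+ 2) / 2.
  rewrite !enorm_sqr -big_split /= mulr_suml; apply: ler_sum => c _.
  set a := grad f (_ + _); set b := grad f x.
  have -> : (a - b) ord0 c = a ord0 c - b ord0 c by rewrite !mxE.
  have := sqr_ge0 (a ord0 c - b ord0 c - v ord0 c); nra.
lra.
Qed.

(** Cauchy-Schwarz against a constant: the square is a double sum, and [u t * u q] is at most the
    mean of the two squares. *)
Lemma sqr_sum_le (R : realType) (u : nat -> R) (a b : nat) :
  (\sum_(a <= t < b) u t) ^+ 2 <= (b - a)%:R * \sum_(a <= t < b) u t ^+ 2.
Proof.
have -> : (b - a)%:R * \sum_(a <= t < b) u t ^+ 2 =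
    \sum_(a <= t < b) \sum_(a <= q < b) (u t ^+ 2 + u q ^+ 2) / 2.
  under [RHS]eq_bigr do rewrite -mulr_suml big_split /= sumr_const_nat.
  rewrite -mulr_suml big_split /= sumr_const_nat sumrMnl mulr_natl; lra.
rewrite expr2 mulr_suml; apply: ler_sum => t _.
rewrite mulr_sumr; apply: ler_sum => q _; have := sqr_ge0 (u t - u q); nra.
Qed.

Lemma ler_sum_nat_widen (R : realType) (F : nat -> R) (a b c d : nat) :
  (forall t, 0 <= F t) -> (c <= a)%N -> (b <= d)%N ->
  \sum_(a <= t < b) F t <= \sum_(c <= t < d) F t.
Proof.
move=> F0 ca bd; have [ba|ab] := leqP b a.
  by rewrite big_geq // sumr_ge0.
rewrite (@big_cat_nat _ _ _ a c d) // ?(leq_trans (ltnW ab)) //.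
rewrite (@big_cat_nat _ _ _ b a d) ?(ltnW ab) //=.
have sum_ge0 p q : 0 <= \sum_(p <= t < q) F t by rewrite sumr_ge0.
by have := sum_ge0 c a; have := sum_ge0 b d; lra.
Qed.

(** * Drift of the local copies *)

Section AsynchronousBCD.
Context {R : realType} {n : nat} {m_ : 'I_n -> nat}.
Local Notation vec := 'rV[R]_(\sum_(i < n) m_ i).
Context (f : vec -> R) (T : 'I_n -> set nat).
Context (tau : 'I_n -> 'I_n -> nat -> nat) (B : nat).
Context (gamma : R) (x : 'I_n -> nat -> vec).

Local Notation X := (true_state x).
Local Notation s := (direction f T x).
Local Notation energy a b := (\sum_(a <= t < b) enorm (s t%:Z) ^+ 2).

(** Blocks are handled through coordinates: [tagnat.sig1 c] is the block of [c], and [tagnat.sig2 c]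
    its position there. *)
Lemma eq_submxrow_coord (u v : vec) c :
  submxrow u (tagnat.sig1 c) = submxrow v (tagnat.sig1 c) ->
  u ord0 c = v ord0 c.
Proof.
by move=> /matrixP /(_ ord0 (tagnat.sig2 c)); rewrite !mxE tagnat.sig2K.
Qed.

Lemma true_stateE t c : X t ord0 c = x (tagnat.sig1 c) t ord0 c.
Proof. by rewrite !mxE tagnat.sig2K. Qed.

Lemma directionE (t : nat) c :
  s t ord0 c =
  if t \in T (tagnat.sig1 c) then - grad f (x (tagnat.sig1 c) t) ord0 c else 0.
Proof. by rewrite mxE; case: ifP => _; rewrite ?mxE ?tagnat.sig2K. Qed.

Hypothesis x_bcd : async_bcd f T tau gamma x.

Lemma true_stateS_coord (t : nat) c :
  X t.+1 ord0 c = X t ord0 c + gamma * s t ord0 c.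
Proof.
rewrite !true_stateE directionE.
have [/(_ (tagnat.sig1 c) t) /matrixP /(_ ord0 (tagnat.sig2 c)) xS _] := x_bcd.
move: xS; case: ifP => _; rewrite !mxE !tagnat.sig2K => ->.
  by rewrite mulrN.
by rewrite mulr0 addr0.
Qed.

Lemma true_stateS (t : nat) : X t.+1 = X t + gamma *: s t.
Proof.
apply/matrixP => i c; rewrite ord1 true_stateS_coord.
by rewrite [RHS]mxE; congr (_ + _); rewrite [RHS]mxE.
Qed.

Hypothesis T_tau_async : partially_asynchronous T tau B.
Hypothesis B_gt0 : (0 < B)%N.

(** The date [u] depends on [c]: a copy mixes values of several ages and need not equal any past
    true state. Drift is therefore measured coordinate by coordinate. *)
Lemma copy_stale i t c : t \in T i ->
  exists2 u, (t < u + B)%N && (u <= t)%N & x i t ord0 c = X u ord0 c.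
Proof.
move=> Tit; have [ci|ci] := eqVneq (tagnat.sig1 c) i.
  by exists t; [lia | rewrite true_stateE ci].
have [_ /(_ i (tagnat.sig1 c) t ci Tit) [u1 u2]] := T_tau_async.
exists (tau i (tagnat.sig1 c) t); first by rewrite u1.
have [_ /(_ i (tagnat.sig1 c) t ci)] := x_bcd.
by rewrite true_stateE; exact: eq_submxrow_coord.
Qed.

Lemma true_state_drift a b p q c :
  (a <= p <= b)%N -> (a <= q <= b)%N ->
  (X p ord0 c - X q ord0 c) ^+ 2
    <= gamma ^+ 2 * (b - a)%:R * \sum_(a <= t < b) s t%:Z ord0 c ^+ 2.
Proof.
wlog qp : p q / (q <= p)%N => [hw ap aq|/andP[ap pb] /andP[aq qb]].
  have [qp|/ltnW pq] := leqP q p; first exact: hw.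
  by rewrite -sqrrN opprB; exact: hw.
have -> : X p ord0 c - X q ord0 c = gamma * \sum_(q <= t < p) s t%:Z ord0 c.
  rewrite -(telescope_sumr (fun t => X t ord0 c) qp) mulr_sumr.
  by apply: eq_bigr => t _; rewrite true_stateS_coord addrC addKr.
rewrite exprMn -mulrA ler_wpM2l ?sqr_ge0 //.
apply: le_trans (sqr_sum_le _ _ _) _; apply: ler_pM => //.
- by rewrite sumr_ge0 // => t _; exact: sqr_ge0.
- by rewrite ler_nat; lia.
- by apply: ler_sum_nat_widen => // t; exact: sqr_ge0.
Qed.

(** All dates given by [copy_stale] lie in the one window from [a] to [b], so the coordinatewise
    bounds add up to its energy. *)
Lemma copy_drift a b p i t :
  (a <= p <= b)%N -> (a <= t.+1 - B)%N -> (t <= b)%N -> t \in T i ->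
  enorm (X p - x i t) ^+ 2 <= gamma ^+ 2 * (b - a)%:R * energy a b.
Proof.
move=> pab a_t tb Tit.
under [X in _ <= _ * X]eq_bigr do rewrite enorm_sqr.
rewrite enorm_sqr exchange_big mulr_sumr; apply: ler_sum => c _.
have [u ut xu] := copy_stale c Tit.
have -> : (X p - x i t) ord0 c = X p ord0 c - X u ord0 c by rewrite -xu !mxE.
by apply: true_state_drift => //; lia.
Qed.

(** * Gradients evaluated at outdated copies *)

Hypothesis f_C1 : continuously_differentiable f.
Context (L : R).
Hypothesis f_lip : lipschitz_grad f L.

(** Summing every coordinate over every processor, though each processor only updates its own block,
    costs a factor [n] but avoids sums over blocks. *)
Lemma sum_grad_drift (P : pred 'I_n) (t : 'I_n -> nat) (p : nat) e :
  0 <= e -> (forall i, P i -> enorm (X p - x i (t i)) ^+ 2 <= e) ->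
  \sum_c \sum_(i | P i)
     (grad f (X p) ord0 c - grad f (x i (t i)) ord0 c) ^+ 2
    <= n%:R * (L ^+ 2 * e).
Proof.
move=> e0 Xx; have Le0 : 0 <= L ^+ 2 * e by rewrite mulr_ge0 ?sqr_ge0.
rewrite exchange_big /= -[n in n%:R]card_ord -sum1_card natr_sum mulr_suml.
rewrite [leLHS]big_mkcond; apply: ler_sum => i _; rewrite mul1r.
case: ifP => // Pi.
apply: le_trans (_ : L ^+ 2 * enorm (X p - x i (t i)) ^+ 2 <= _).
  apply: le_trans (lipschitz_grad_sqr _ _ f_lip); rewrite enorm_sqr.
  by apply: ler_sum => c _; rewrite !mxE.
by rewrite ler_wpM2l ?sqr_ge0 ?Xx.
Qed.

Lemma step_descent (t : nat) e :
  0 <= e -> (forall i, t \in T i -> enorm (X t - x i t) ^+ 2 <= e) ->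
  f (X t.+1) <= f (X t) - gamma * (1 - gamma * (L ^+ 2 + 2) / 2)
                          * enorm (s t) ^+ 2 + n%:R * (L ^+ 2 * e) / 2.
Proof.
move=> e0 Xx; rewrite true_stateS.
have := lipschitz_grad_descent (X t) (gamma *: s t) f_C1 f_lip.
have := @sum_grad_drift (fun i => t \in T i) (fun=> t) t e e0 Xx.
set D := \sum_c _ => DL.
have -> : enorm (gamma *: s t) ^+ 2 = gamma ^+ 2 * enorm (s t) ^+ 2.
  by rewrite !enorm_sqr mulr_sumr; apply: eq_bigr => c _; rewrite mxE exprMn.
have : \sum_c grad f (X t) ord0 c * (gamma *: s t) ord0 c
    <= (gamma ^+ 2 / 2 - gamma) * enorm (s t) ^+ 2 + D / 2.
  rewrite enorm_sqr mulr_sumr mulr_suml -big_split /=; apply: ler_sum => c _.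
  have -> : (gamma *: s t) ord0 c = gamma * s t ord0 c by rewrite mxE.
  rewrite directionE; case: ifP => tT; last first.
    rewrite expr0n /= !mulr0 add0r divr_ge0 // sumr_ge0 // => i _.
    exact: sqr_ge0.
  (* Of the terms of [D] at [c], only that of the processor owning [c] is used. *)
  rewrite [X in _ + X / 2](bigD1 (tagnat.sig1 c)) //=.
  set g' := grad f (x _ _) ord0 c; set g := grad f _ ord0 c.
  set rest := \sum_(i < n | _ && _) _.
  have rest0 : 0 <= rest by rewrite sumr_ge0 // => i _; exact: sqr_ge0.
  (* This gives [- gamma * g * g' <= (gamma ^+ 2 / 2 - gamma) * g' ^+ 2 + (g - g') ^+ 2 / 2]. *)
  have := sqr_ge0 (g - g' + gamma * g'); nra.
nra.
Qed.

(** Each block of the gradient is compared with one update of that block. The factor [3 / 2] must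
    stay below 2: with 2, [lyapunov_step] would have no slack. *)
Lemma grad_le_energy (a b p : nat) e :
  0 <= e ->
  (forall i, exists2 t, (a <= t < b)%N && (t \in T i)
                      & enorm (X p - x i t) ^+ 2 <= e) ->
  enorm (grad f (X p)) ^+ 2 <= 3 / 2 * energy a b + 3 * (n%:R * (L ^+ 2 * e)).
Proof.
move=> e0 /fin_all_exists2[t abT Xx].
have := @sum_grad_drift predT t p e e0 (fun i _ => Xx i).
set D := \sum_c _ => DL.
apply: le_trans (_ : 3 / 2 * energy a b + 3 * D <= _); last lra.
under [energy a b]eq_bigr do rewrite enorm_sqr.
rewrite enorm_sqr exchange_big [X in X + _]mulr_sumr [X in _ + X]mulr_sumr
  -big_split; apply: ler_sum => c _.
rewrite /=; set i := tagnat.sig1 c; have /andP[tab tT] := abT i.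
rewrite [X in _ + 3 * X](bigD1 i) //=.
rewrite [X in 3 / 2 * X + _](bigD1_seq (t i)) ?mem_index_iota ?iota_uniq //=.
rewrite directionE tT.
set g' := grad f (x _ _) ord0 c; set g := grad f _ ord0 c.
set rest := \sum_(j < n | j != i) _; set rest' := \sum_(a <= j < b | _) _.
have rest0 : 0 <= rest by rewrite sumr_ge0 // => j _; exact: sqr_ge0.
have rest0' : 0 <= rest' by rewrite sumr_ge0 // => j _; exact: sqr_ge0.
(* Half this square is [3 / 2 * g' ^+ 2 + 3 * (g - g') ^+ 2 - g ^+ 2]. *)
have := sqr_ge0 (3 * g' - 2 * g); nra.
Qed.

(* Truncated subtraction makes P 0 an empty sum: directions at negative times *)
(* vanish.                                                                    *)
Local Notation P k := (energy (k * B - B) (k * B)).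
(** One constant for two estimates: [block_descent] needs [(L ^+ 2 + 2) / 2 + n * L ^+ 2 * B ^+ 2],
    and [block_energy] needs [6 * n * L ^+ 2 * B]. *)
Local Notation K := (2 + L ^+ 2 + 6 * n%:R * L ^+ 2 * B%:R ^+ 2).

(** * Estimates over one block of [B] steps *)

Lemma energy_ge0 a b : 0 <= energy a b.
Proof. by rewrite sumr_ge0 // => t _; exact: sqr_ge0. Qed.

Lemma block_drift k p i t :
  (k * B <= p <= k.+1 * B)%N -> (k * B <= t < k.+1 * B)%N -> t \in T i ->
  enorm (X p - x i t) ^+ 2 <= gamma ^+ 2 * (2 * B%:R) * (P k + P k.+1).
Proof.
move=> kp kt tT.
have -> : P k + P k.+1 = energy (k * B - B) (k.+1 * B).
  by rewrite mulSn addKn -big_cat_nat //=; lia.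
apply: le_trans (copy_drift (a := k * B - B) (b := k.+1 * B) _ _ _ tT) _; try lia.
(* The window has length [2 * B], except [B] when [k] is 0. *)
rewrite ler_wpM2r ?energy_ge0 // ler_wpM2l ?sqr_ge0 // -natrM ler_nat; lia.
Qed.

Lemma block_descent k :
  f (X (k.+1 * B)) <= f (X (k * B)) - gamma * (1 - gamma * K) * P k.+1
                      + gamma ^+ 2 * K * P k.
Proof.
set e := gamma ^+ 2 * (2 * B%:R) * (P k + P k.+1).
have e0 : 0 <= e.
  by rewrite /e mulr_ge0 ?addr_ge0 ?energy_ge0 // mulr_ge0 ?sqr_ge0.
have le_sum : f (X (k.+1 * B)) - f (X (k * B)) <=
  \sum_(k * B <= t < k.+1 * B)
    (- (gamma * (1 - gamma * (L ^+ 2 + 2) / 2)) * enorm (s t) ^+ 2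
      + n%:R * (L ^+ 2 * e) / 2).
  rewrite -(telescope_sumr (fun t => f (X t))) ?leq_pmul2r //.
  apply: ler_sum_nat => t kt.
  have kt' : (k * B <= t <= k.+1 * B)%N by lia.
  by have := step_descent e0 (fun i tT => block_drift kt' kt tT); lra.
rewrite big_split /= -mulr_sumr sumr_const_nat mulSn addnK in le_sum.
rewrite -[_ *+ B]mulr_natr in le_sum.
have := energy_ge0 (k * B - B) (k * B).
have := energy_ge0 (k.+1 * B - B) (k.+1 * B).
move: le_sum; rewrite /e mulSn addKn.
set Q := energy (k * B) _; set Q' := energy _ _.
set b := B%:R; set N := n%:R; set y := f _; set y' := f _.
move=> le Q0 Q0'.
have g2 : 0 <= gamma ^+ 2 by exact: sqr_ge0.
have gL : 0 <= gamma ^+ 2 * L ^+ 2 by rewrite mulr_ge0 ?sqr_ge0.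
have gLb : 0 <= gamma ^+ 2 * (N * L ^+ 2 * b ^+ 2).
  by rewrite mulr_ge0 // mulr_ge0 ?sqr_ge0 // mulr_ge0 ?sqr_ge0 // ler0n.
have := mulr_ge0 gLb Q0; have := mulr_ge0 gLb Q0'.
have := mulr_ge0 gL Q0; have := mulr_ge0 gL Q0'.
have := mulr_ge0 g2 Q0; have := mulr_ge0 g2 Q0'.
lra.
Qed.

Lemma block_energy k (fstar mu : R) : PL f fstar mu ->
  2 * mu * (f (X (k * B)) - fstar) <=
    3 / 2 * P k.+1 + gamma ^+ 2 * K * (P k + P k.+1).
Proof.
move=> /(_ (X (k * B))) fPL.
set e := gamma ^+ 2 * (2 * B%:R) * (P k + P k.+1).
have PP0 : 0 <= P k + P k.+1 by rewrite addr_ge0 ?energy_ge0.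
have e0 : 0 <= e by rewrite /e mulr_ge0 // mulr_ge0 ?sqr_ge0.
have /(grad_le_energy e0) : forall i, exists2 t,
    (k * B <= t < k.+1 * B)%N && (t \in T i)
    & enorm (X (k * B) - x i t) ^+ 2 <= e.
  move=> i; have [/(_ i (k * B)%N) [t kt tT] _] := T_tau_async.
  have kt' : (k * B <= t < k.+1 * B)%N by lia.
  exists t; first by rewrite kt' tT.
  by apply: block_drift => //; lia.
have -> : energy (k * B) (k.+1 * B) = P k.+1 by rewrite mulSn addKn.
move: PP0 fPL; rewrite /e.
set Q := P k; set Q' := P k.+1; set y := f _; set g := enorm _ ^+ 2.
have b1 : 1 <= B%:R :> R by rewrite ler1n.
set b := B%:R in b1 *; set N := n%:R => PP0 fPL le.
have g2 : 0 <= gamma ^+ 2 by exact: sqr_ge0.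
have gL : 0 <= gamma ^+ 2 * L ^+ 2 by rewrite mulr_ge0 ?sqr_ge0.
(* Replaces [B] by [B ^+ 2] to fit [K]. *)
have gLb : 0 <= gamma ^+ 2 * (N * L ^+ 2 * (b * (b - 1))).
  rewrite mulr_ge0 // mulr_ge0 ?(mulr_ge0 (ler0n _ _) (sqr_ge0 _)) //.
  by rewrite mulr_ge0 ?subr_ge0 // ler0n.
have := mulr_ge0 gLb PP0; have := mulr_ge0 gL PP0; have := mulr_ge0 g2 PP0.
lra.
Qed.

End AsynchronousBCD.

(* K bounds the constants of block_descent and block_energy. The weight       *)
(* gamma/8 leaves slack since energy gives about (4/3) mu g <= P'.            *)
Lemma lyapunov_step (R : realType) (gamma mu K g g' P P' : R) :
  0 < gamma -> gamma <= 1 -> 0 <= K ->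
  gamma * K <= 32^-1 -> gamma * mu <= 32^-1 ->
  0 <= P -> 0 <= P' ->
  g' <= g - gamma * (1 - gamma * K) * P' + gamma ^+ 2 * K * P ->
  2 * mu * g <= 3 / 2 * P' + gamma ^+ 2 * K * (P + P') ->
  g' + gamma / 8 * P' <= (1 - gamma * mu) * (g + gamma / 8 * P).
Proof.
move=> gamma0 gamma1 K0 gK gmu P0 P0' descent energy.
have gP : 0 <= gamma * P by rewrite mulr_ge0 // ltW.
have gP' : 0 <= gamma * P' by rewrite mulr_ge0 // ltW.
have a0 : 0 <= gamma * K by rewrite mulr_ge0 // ltW.
have ga : gamma * (gamma * K) <= 32^-1 by nra.
have gaP : gamma * (gamma * K) * (gamma * (P + P')) <= 32^-1 * (gamma * (P + P')).
  by apply: ler_wpM2r; lra.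
have := ler_wpM2l (ltW gamma0) energy.
have := ler_wpM2r gP gK; have := ler_wpM2r gP' gK; have := ler_wpM2r gP gmu.
(* In units of [gamma], [P'] costs 1/32 + 1/8 + 3/4 + 1/64 = 59/64 out of 1, and [P] costs 1/32 +
   1/64 + 1/256 = 13/256 out of 1/8. *)
lra.
Qed.

Theorem theorem1 (R : realType) (n : nat) (m_ : 'I_n -> nat)
  (f : 'rV[R]_(\sum_(i < n) m_ i) -> R) (fstar mu L : R)
  (T : 'I_n -> set nat) (tau : 'I_n -> 'I_n -> nat -> nat) (B : nat)
  (f_C1 : continuously_differentiable f)
  (fstar_min : is_min_value f fstar)
  (mu_gt0 : 0 < mu)
  (f_PL : PL f fstar mu)
  (crit_neq0 : [set x | grad f x = 0] !=set0)
  (crit_finite : finite_set [set x | grad f x = 0])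
  (f_lip : lipschitz_grad f L)
  (tau_causal : causal tau)
  (B_gt0 : (0 < B)%N)
  (T_tau_async : partially_asynchronous T tau B) :
  exists gamma0 : R, 0 < gamma0 < 1 /\
    forall gamma : R, 0 < gamma < gamma0 ->
    forall x : 'I_n -> nat -> 'rV[R]_(\sum_(i < n) m_ i),
      async_bcd f T tau gamma x ->
      exists eta : R, 0 < eta /\
        forall k : nat,
          f (true_state x (k * B)%N) - fstar
            <= (1 - gamma * mu) ^ (k%:Z - 1) * eta /\
          gamma ^+ 2 *
            (\sum_(j < B)
               enorm (direction f T x ((k%:Z - 1) * B%:Z + j%:Z)) ^+ 2)
            <= (1 - gamma * mu) ^ (k%:Z - 1) * eta.
Proof.
set K : R := 2 + L ^+ 2 + 6 * n%:R * L ^+ 2 * B%:R ^+ 2.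
have K2 : 2 <= K.
  rewrite /K -addrA lerDl addr_ge0 ?sqr_ge0 //.
  by rewrite mulr_ge0 ?sqr_ge0 // mulr_ge0 ?sqr_ge0 // mulr_ge0 ?ler0n.
have Kmu : 0 < 32 * (K + mu) by lra.
(* This makes both [gamma * K] and [gamma * mu] at most 1/32; [K2] keeps it below 1. *)
exists (32 * (K + mu))^-1; split.
  by rewrite invr_gt0 Kmu invf_lt1 //=; lra.
move=> gamma /andP[gamma0 gammaK] x x_bcd.
have {}gammaK : gamma * (32 * (K + mu)) <= 1.
  by rewrite -ler_pdivlMr // mul1r ltW.
have gK : gamma * K <= 32^-1 by have := mulr_gt0 gamma0 mu_gt0; lra.
have gmu : gamma * mu <= 32^-1 by nra.
have g32 : gamma <= 32^-1 by nra.
set X := true_state x.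
pose P k := \sum_(k * B - B <= t < k * B) enorm (direction f T x t%:Z) ^+ 2.
pose V k := f (X (k * B)%N) - fstar + gamma / 8 * P k.
have P0 k : 0 <= P k by exact: energy_ge0.
have gap0 k : 0 <= f (X k) - fstar.
  by rewrite subr_ge0; case: fstar_min.
have VS k : V k.+1 <= (1 - gamma * mu) * V k.
  apply: (@lyapunov_step _ gamma mu K) => //; [lra|lra| |].
    by have := block_descent x_bcd T_tau_async B_gt0 f_C1 f_lip k;
       rewrite -/(P k) -/(P k.+1) -/K -/X; lra.
  exact: (block_energy x_bcd T_tau_async B_gt0 f_lip k f_PL).
have gmu0 := mulr_gt0 gamma0 mu_gt0.
set rho := 1 - gamma * mu in VS *.
have rho0 : 0 < rho by rewrite /rho; lra.
have VX k : V k <= rho ^+ k * V 0%N.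
  elim: k => [|k IH]; first by rewrite mul1r.
  by rewrite exprS -mulrA (le_trans (VS k)) // ler_pM2l.
have V0 k : 0 <= V k by rewrite addr_ge0 ?gap0 ?mulr_ge0 ?P0 ?divr_ge0 // ltW.
(* [V 0] is the initial gap, as [P 0] is empty; adding 1 keeps the constant positive when the start
   is a minimizer. *)
exists (V 0%N + 1); split; first by have := V0 0%N; lra.
move=> k.
have bound : V k <= rho ^ (k%:Z - 1) * (V 0%N + 1).
  apply: le_trans (VX k) _; apply: ler_pM; rewrite ?exprn_ge0 ?V0 //; try lra.
  rewrite expfzDr ?gt_eqF // -[rho ^ k%:Z]/(rho ^+ k) ler_peMr ?exprn_ge0 ?ltW //.
  by rewrite invf_gt1 // /rho; lra.
have gP : 0 <= gamma / 8 * P k by rewrite mulr_ge0 ?P0 ?divr_ge0 // ltW.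
split; first by apply: le_trans bound; rewrite lerDl.
suff -> : \sum_(j < B) enorm (direction f T x ((k%:Z - 1) * B%:Z + j%:Z)) ^+ 2
    = P k.
  apply: le_trans bound; apply: le_trans (_ : gamma / 8 * P k <= _).
    (* [gamma ^+ 2 <= gamma / 8] because [gamma <= 32^-1]. *)
    by rewrite ler_wpM2r // expr2 ler_wpM2l //; lra.
  by rewrite lerDr gap0.
rewrite /P; case: k {VX bound gP} => [|k].
  rewrite big_geq //; apply: big1 => j _.
  (* For [k = 0] all times are negative, where the direction is 0; [Negz p] stands for
     [- (p + 1)]. *)
  have -> : ((0%:Z - 1) * B%:Z + j%:Z)%R = Negz (B - j.+1).
    by have := ltn_ord j; lia.
  by rewrite enorm_sqr big1 // => c _; rewrite mxE expr0n.
rewrite mulSn addKn -[X in \sum_(X <= _ < _) _]add0n big_addn addnK big_mkord.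
apply: eq_bigr => j _; congr (enorm (direction f T x _) ^+ 2); lia.
Qed.
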